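(* Let $G$ be a connected graph with $n$ vertices and $m$ edges. Then $$MS^{1}(G)\ \ge\ 4(n-1)W(G)-MS_1(G)\ \ge\ 4(n-1)\left(n^2-n-m\right)-MS_1(G),$$ and equalities hold on both sides simultaneously if $\mathrm{diam}(G)\le 2$.
   Context: All graphs are finite and simple. $d(u)$ is the degree of a vertex $u$; $d(u,v)$ is the graph distance; the transmission of $v$ is $\sigma(v)=\sum_{u\in V(G)}d(v,u)$; $\mathrm{diam}(G)$ is the maximum distance between two vertices. $MS^{1}(G)=\sum_{u\in V(G)}\sigma(u)^2$ (superscript 1 is an index parameter), $MS_1(G)=\sum_{uv\in E(G)}(\sigma(u)+\sigma(v))=\sum_{u\in V(G)}d(u)\sigma(u)$, and the Wiener index is $W(G)=\frac12\sum_{u\in V(G)}\sigma(u)$. *)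

(* Defs.v *)
From HB Require Import structures.
From mathcomp Require Import all_boot all_order all_algebra.

Set Implicit Arguments.
Unset Strict Implicit.
Unset Printing Implicit Defensive.

Import Order.TTheory GRing.Theory Num.Theory.

Record sgraph := SGraph {
  vertex :> finType;
  adj : rel vertex;
  adj_sym : symmetric adj;
  adj_irrefl : irreflexive adj
}.

Definition edges (G : sgraph) : {set {set G}} :=
  [set A : {set G} | [exists u, exists v, adj u v && (A == [set u; v])]].

Definition graph_connected (G : sgraph) : Prop :=
  forall u v : G, connect (@adj G) u v.

Definition walk_of_length (G : sgraph) (u v : G) (k : nat) : bool :=
  [exists p : k.-tuple G, path (@adj G) u p && (last u p == v)].

(* The least length of a walk from u to v.  A shortest walk has length < #|G|,
   so the search range is exhaustive; the value is #|G| when u and v lie in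
   different components. *)
Definition dist (G : sgraph) (u v : G) : nat :=
  find (walk_of_length u v) (iota 0 #|G|).

Definition transmission (G : sgraph) (v : G) : nat := \sum_(u : G) dist v u.

Definition diam (G : sgraph) : nat := \max_(u : G) \max_(v : G) dist u v.

Definition MS_sup1 (G : sgraph) : nat := \sum_(u : G) transmission u ^ 2.

(* Over an edge e = {u, v} the inner sum is transmission u + transmission v,
   since u and v are distinct. *)
Definition MS_sub1 (G : sgraph) : nat :=
  \sum_(e in edges G) \sum_(u in e) transmission u.

(* Rational-valued, so that neither the halving nor the subtractions in
   inequalities about it are truncated. *)
Definition Wiener (G : sgraph) : rat :=
  (2%:R^-1 * (\sum_(u : G) transmission u)%N%:R)%R.

(* Main.v *)
Require Import Defs.
From mathcomp Require Import all_boot all_order all_algebra.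
From mathcomp Require Import ring lra.

Set Implicit Arguments.
Unset Strict Implicit.
Unset Printing Implicit Defensive.

Import Order.TTheory GRing.Theory Num.Theory.
Local Open Scope ring_scope.

(** Everything follows from one bound, [transmission_degree_ge]: for every
    vertex [u] of a graph with [n] vertices,
      [2 (n - 1) <= sigma(u) + d(u)].
    Indeed, each of the [n - 1] vertices [v] other than [u] contributes to the
    right-hand side [1 + 1] if it is adjacent to [u], and at least [2 + 0] if
    it is not.  When the diameter is at most [2] each contribution is exactly
    [2], and the bound is an equality.

    Multiplying the bound by [sigma(u)] and summing over [u] gives
      [2 (n - 1) * 2 W <= MS^1 + sum_u d(u) sigma(u)],
    and the last sum is [MS_1] by double counting the incidences between
    vertices and edges ([sum_edges_incident]).  Summing the bound itself gives
      [2 n (n - 1) <= 2 W + 2 m]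
    by the handshake lemma, the case of constant weight of the same double
    count; multiplied by [2 (n - 1)], nonnegative once there is a vertex, this
    is the second inequality. Both inequalities are nonnegative combinations
    of instances of the one bound, so both become equalities with it. *)

Definition degree (G : sgraph) (u : G) : nat := \sum_(v : G) adj u v.

Lemma walk_of_length0 (G : sgraph) (u v : G) :
  walk_of_length u v 0 = (u == v).
Proof.
apply/existsP/eqP => [[p] | ->]; first by rewrite tuple0 /= => /eqP.
by exists [tuple] => /=.
Qed.

Lemma walk_of_length1 (G : sgraph) (u v : G) :
  walk_of_length u v 1 = adj u v.
Proof.
apply/existsP/idP => [[p] | uv].
  case/tupleP: p => w p; rewrite tuple0 /= andbT.
  by case/andP=> uw /eqP <-.
by exists [tuple v]; rewrite /= uv eqxx.
Qed.

Lemma dist_self (G : sgraph) (u : G) : dist u u = 0%N.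
Proof.
rewrite /dist; case: #|G| => [//|k] /=.
by rewrite walk_of_length0 eqxx.
Qed.

(** Two distinct vertices force [1 < #|G|], so the search for a shortest walk
    tries both lengths [0] and [1]; it passes over [0], and stops at [1]
    exactly on an edge. *)
Lemma dist_neq (G : sgraph) (u v : G) : u != v ->
  if adj u v then dist u v = 1%N else (1 < dist u v)%N.
Proof.
move=> neq_uv.
have : (1 < #|G|)%N by apply/card_gt1P; exists u, v.
rewrite /dist; case: #|G| => [|[|k]] //= _.
rewrite walk_of_length0 (negPf neq_uv) walk_of_length1.
by case: (adj u v).
Qed.

Lemma dist_adj_ge (G : sgraph) (u v : G) :
  ((u != v) * 2 <= dist u v + adj u v)%N.
Proof.
case: eqVneq => [//|/dist_neq]; case: (adj u v) => [->//|].
by rewrite addn0.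
Qed.

Lemma dist_adj_eq (G : sgraph) (u v : G) : (dist u v <= 2)%N ->
  ((u != v) * 2 = dist u v + adj u v)%N.
Proof.
case: eqVneq => [-> _|/dist_neq]; first by rewrite dist_self adj_irrefl.
case: (adj u v) => [->//|d_gt1 d_le2].
by rewrite addn0; apply/eqP; rewrite eqn_leq d_gt1.
Qed.

Lemma sum_neq (T : finType) (u : T) :
  (\sum_(v : T) (u != v) * 2 = 2 * #|T|.-1)%N.
Proof.
rewrite -big_distrl /= mulnC -(cardC1 u) -sum1_card; congr (_ * _)%N.
rewrite [RHS]big_mkcond; apply: eq_bigr => v _.
by rewrite inE eq_sym; case: eqP.
Qed.

Lemma transmission_degree_ge (G : sgraph) (u : G) :
  (2 * #|G|.-1 <= transmission u + degree u)%N.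
Proof.
rewrite -(sum_neq u) -big_split /=.
by apply: leq_sum => v _; apply: dist_adj_ge.
Qed.

Lemma transmission_degree_eq (G : sgraph) (u : G) : (diam G <= 2)%N ->
  (2 * #|G|.-1 = transmission u + degree u)%N.
Proof.
move=> diam_le2; rewrite -(sum_neq u) -big_split /=.
apply: eq_bigr => v _; apply: dist_adj_eq; apply: leq_trans diam_le2.
apply: leq_trans (leq_bigmax (F := fun w => dist u w) v) _.
exact: (leq_bigmax (F := fun x => \max_(y : G) dist x y)%N u).
Qed.

(** The edges through [u] correspond to its neighbours under
    [v |-> {u, v}]. *)
Lemma card_incident_edges (G : sgraph) (u : G) :
  #|[set e in edges G | u \in e]| = degree u.
Proof.
have -> : [set e in edges G | u \in e]
          = [set [set u; v] | v in [set v | adj u v]].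
  apply/setP => e; rewrite !inE; apply/andP/imsetP.
    case=> /existsP[x /existsP[y /andP[xy /eqP ->]]].
    rewrite !inE => /orP[] /eqP ->; first by exists y; rewrite ?inE.
    by exists x; rewrite ?inE 1?adj_sym // setUC.
  case=> v; rewrite inE => uv ->; rewrite !inE eqxx; split=> //.
  by apply/existsP; exists u; apply/existsP; exists v; rewrite uv eqxx.
rewrite card_in_imset.
  by rewrite cardsE -sum1_card big_mkcond; apply: eq_bigr.
move=> v w; rewrite !inE => uv _ /setP/(_ v).
rewrite !inE eqxx orbT => /esym/orP[] /eqP // v_u.
by rewrite v_u adj_irrefl in uv.
Qed.

Lemma sum_edges_incident (G : sgraph) (f : G -> nat) :
  (\sum_(e in edges G) \sum_(u in e) f u = \sum_(u : G) f u * degree u)%N.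
Proof.
rewrite (exchange_big_dep xpredT) //=; apply: eq_bigr => u _.
rewrite -card_incident_edges sum_nat_const mulnC; congr (_ * _)%N.
by rewrite cardsE.
Qed.

Lemma handshake (G : sgraph) : (\sum_(u : G) degree u = 2 * #|edges G|)%N.
Proof.
transitivity (\sum_(u : G) 1 * degree u)%N.
  by apply: eq_bigr => u _; rewrite mul1n.
rewrite -(sum_edges_incident (fun=> 1%N)) mulnC -sum_nat_const.
apply: eq_bigr => e; rewrite inE => /existsP[u /existsP[v /andP[uv /eqP ->]]].
rewrite sum1_card cards2; case: eqVneq uv => // ->.
by rewrite adj_irrefl.
Qed.

(** The two sides that the bound on [sigma(u) + d(u)] compares, once it is
    multiplied by [sigma(u)] and summed. *)
Lemma sum_transmission_mul (G : sgraph) :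
  (\sum_(u : G) transmission u * (transmission u + degree u)
   = MS_sup1 G + MS_sub1 G)%N.
Proof.
rewrite /MS_sup1 /MS_sub1 sum_edges_incident -big_split /=.
by apply: eq_bigr => u _; rewrite mulnDr.
Qed.

Lemma sum_transmission_degree (G : sgraph) :
  (\sum_(u : G) (transmission u + degree u)
   = \sum_(u : G) transmission u + 2 * #|edges G|)%N.
Proof. by rewrite big_split /= handshake. Qed.

Theorem proposition12 (G : sgraph) (n m : nat)
    (G_connected : graph_connected G)
    (card_G : #|G| = n) (card_edges : #|edges G| = m) :
  [/\ (MS_sup1 G)%:R >= 4 * (n%:R - 1) * Wiener G - (MS_sub1 G)%:R,
      4 * (n%:R - 1) * Wiener G - (MS_sub1 G)%:R
        >= 4 * (n%:R - 1) * (n%:R ^+ 2 - n%:R - m%:R) - (MS_sub1 G)%:R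
    & (diam G <= 2)%N ->
      (MS_sup1 G)%:R = 4 * (n%:R - 1) * Wiener G - (MS_sub1 G)%:R /\
      4 * (n%:R - 1) * Wiener G - (MS_sub1 G)%:R
        = 4 * (n%:R - 1) * (n%:R ^+ 2 - n%:R - m%:R) - (MS_sub1 G)%:R].
Proof.
pose S := (\sum_(u : G) transmission u)%N.
have sumS : (S * (2 * #|G|.-1)
             = \sum_(u : G) transmission u * (2 * #|G|.-1))%N.
  by rewrite big_distrl.
have sum2 : (#|G| * (2 * #|G|.-1) = \sum_(u : G) 2 * #|G|.-1)%N.
  by rewrite sum_nat_const.
have le1 : (S * (2 * #|G|.-1) <= MS_sup1 G + MS_sub1 G)%N.
  rewrite sumS -sum_transmission_mul; apply: leq_sum => u _.
  by rewrite leq_mul2l transmission_degree_ge orbT.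
have le2 : (#|G| * (2 * #|G|.-1) <= S + 2 * #|edges G|)%N.
  rewrite sum2 -sum_transmission_degree; apply: leq_sum => u _.
  exact: transmission_degree_ge.
have eq1 : (diam G <= 2)%N -> (S * (2 * #|G|.-1) = MS_sup1 G + MS_sub1 G)%N.
  move=> d2; rewrite sumS -sum_transmission_mul; apply: eq_bigr => u _.
  by rewrite -transmission_degree_eq.
have eq2 : (diam G <= 2)%N -> (#|G| * (2 * #|G|.-1) = S + 2 * #|edges G|)%N.
  move=> d2; rewrite sum2 -sum_transmission_degree; apply: eq_bigr => u _.
  exact: transmission_degree_eq.
rewrite /Wiener -/S; move: le1 le2 eq1 eq2; rewrite card_G card_edges.
case: n card_G => [G0|k _].
  (* On the empty graph the predecessor truncates, but every sum vanishes. *)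
  have no_sum (F : G -> nat) : (\sum_(u : G) F u = 0)%N.
    by apply: big1 => u; have := card0_eq G0 u.
  have m0 : m = 0%N.
    by apply/eqP; rewrite -card_edges -(eqn_pmul2l (isT : 0 < 2)%N)
      -handshake no_sum.
  by rewrite /S /MS_sup1 /MS_sub1 sum_edges_incident !no_sum m0 => *;
    split=> //=; lra.
rewrite -[k.+1.-1]/k -(@natr1 _ k) addrK => le1 le2 eq1 eq2.
have {}le1 : S%:R * (2 * k%:R) <= (MS_sup1 G)%:R + (MS_sub1 G)%:R :> rat.
  by rewrite -!natrM -natrD ler_nat.
have {}le2 : (k%:R + 1) * (2 * k%:R) <= S%:R + 2 * m%:R :> rat.
  by rewrite natr1 -!natrM -natrD ler_nat.
have k_ge0 : 0 <= k%:R :> rat by rewrite ler0n.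
split; [by lra | by nra |] => d2.
have {}eq1 : S%:R * (2 * k%:R) = (MS_sup1 G)%:R + (MS_sub1 G)%:R :> rat.
  by rewrite -!natrM -natrD eq1.
have {}eq2 : (k%:R + 1) * (2 * k%:R) = S%:R + 2 * m%:R :> rat.
  by rewrite natr1 -!natrM -natrD eq2.
have -> : S%:R = (k%:R + 1) * (2 * k%:R) - 2 * m%:R :> rat by lra.
by split; [nra | field].
Qed.
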